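(* Let $s\ge0$ be an integer, let $\mathbf{a}^1,\dots,\mathbf{a}^k$ be pairwise linearly independent vectors in $\mathbb{R}^n$, and suppose $f\in C^s(\mathbb{R}^n)$ has the form $f(\mathbf{x})=\sum_{i=1}^kf_i(\mathbf{a}^i\cdot\mathbf{x})$ with arbitrary functions $f_i:\mathbb{R}\to\mathbb{R}$. Suppose there is a nonsingular linear transformation $T:\mathbb{R}^n\to\mathbb{R}^n$ such that $T\mathbf{a}^i\in\mathbb{Q}^n$ for $i=1,\dots,k$. Then there exist functions $g_i\in C^s(\mathbb{R})$, $i=1,\dots,k$, such that $$f(\mathbf{x})=\sum_{i=1}^kg_i(\mathbf{a}^i\cdot\mathbf{x})\qquad\text{for all }\mathbf{x}\in\mathbb{R}^n.$$
   Context: $C^s$ denotes $s$ times continuously differentiable real functions, with $C^0=C$. No regularity is assumed on the $f_i$. *)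

(* Defs.v *)
From HB Require Import structures.
From mathcomp Require Import all_boot all_order all_algebra.
From mathcomp Require Import all_classical all_reals all_analysis.
Set Implicit Arguments.
Unset Strict Implicit.
Unset Printing Implicit Defensive.
Import Order.TTheory GRing.Theory Num.Theory.
Import numFieldNormedType.Exports.
Local Open Scope classical_set_scope.
Local Open Scope ring_scope.

Definition dotv (R : realType) (n : nat) (u v : 'rV[R]_n) : R :=
  \sum_(j < n) u 0 j * v 0 j.

Definition ratvec (R : realType) (n : nat) (v : 'rV[R]_n) : Prop :=
  exists q : 'rV[rat]_n, v = map_mx ratr q.

(* C^s(R^n): all iterated partial derivatives of order at most s exist
   everywhere and are continuous. *)
Fixpoint class_Cn (R : realType) (n s : nat) (f : 'rV[R]_n -> R) : Prop :=
  continuous f /\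
  match s with
  | 0%N => True
  | s'.+1 => forall i : 'I_n,
      (forall x, derivable f x (delta_mx 0 i)) /\
      class_Cn s' (fun x => 'D_(delta_mx 0 i) f x)
  end.

Definition class_C1 (R : realType) (s : nat) (g : R -> R) : Prop :=
  (forall (m : nat) (x : R), (m < s)%N -> derivable (derive1n m g) x 1) /\
  (forall m : nat, (m <= s)%N -> continuous (derive1n m g)).

(* Main.v *)
Require Import Defs.
From HB Require Import structures.
From mathcomp Require Import all_boot all_order all_algebra.
From mathcomp Require Import all_classical all_reals all_analysis.
From mathcomp Require Import ring lra.
Import Order.TTheory GRing.Theory Num.Theory.
Import numFieldNormedType.Exports.
Local Open Scope classical_set_scope.
Local Open Scope ring_scope.

(* After a linear change of variables the directions are rational, and on a
   generic rational plane the sum becomes F(x, y) = sum_i phi_i(x + beta_i y)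
   with distinct rational beta_i.  Although the phi_i are arbitrary, each of them
   agrees on the rationals with a C^s function, by induction on the number of
   summands.  Moving along (- beta_k, 1) kills the k-th summand, so by induction
   the differences phi_i(t + c_i) - phi_i(t), c_i = beta_i - beta_k, agree on
   the rationals with C^s functions psi_i.  Average F over the points
   (x - beta_k j/N, j/N), j < N.  For the i-th summand the increment of the
   average between two rational points telescopes into a Riemann sum of psi_i,
   hence converges to the increment of Psi_i / c_i with Psi_i' = psi_i; the
   average of F converges to Fbar(x) = int_0^1 F(x - beta_k h, h) dh, which is
   C^s.  So phi_k = Fbar - sum_i Psi_i / c_i + const on the rationals.  The
   resulting C^s functions represent f on a dense set, hence everywhere. *)

(** * Functions of class C^s in one variable *)

Lemma is_derive1_continuous (R : realType) (g : R -> R) (x d : R) :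
  is_derive x 1 g d -> {for x, continuous g}.
Proof. by move=> gd; apply/differentiable_continuous/derivable1_diffP. Qed.

Lemma is_derive_affine (R : realType) (g : R -> R) (b c x d : R) :
  is_derive (c * x + b) 1 g d ->
  is_derive x 1 (fun y => g (c * y + b)) (d * c).
Proof.
move=> gd; have hd : is_derive x (1 : R) (fun y : R => c * y + b) c.
  rewrite -[c in is_derive _ _ _ c]addr0 -[c in is_derive _ _ _ (c + _)]mulr1.
  exact: (@is_deriveD R R R (c \*: id) (cst b)).
exact: (@is_derive1_comp R g (fun y => c * y + b)).
Qed.

Lemma class_C1_continuous (R : realType) (s : nat) (g : R -> R) :
  class_C1 s g -> continuous g.
Proof. by case=> _ /(_ 0%N (leq0n _)). Qed.

(** The recursive form of the class, with the derivative as a witness [g'] in place of iterated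
    [derive1n]; the inductions on [s] below run on it. *)
Lemma class_C1SP (R : realType) (s : nat) (g : R -> R) :
  class_C1 s.+1 g <->
  exists2 g' : R -> R, forall x : R, is_derive x 1 g (g' x) & class_C1 s g'.
Proof.
split=> [[gd gc]|[g' gd [g'd g'c]]].
  exists (derive1 g) => [x|].
    by apply: DeriveDef; [exact: (gd 0%N)|rewrite derive1E].
  split=> [m x ms|m ms]; rewrite -derive1Sn; [exact: gd|exact: gc].
have g'E : derive1 g = g'.
  by apply/funext => x; rewrite derive1E derive_val.
split=> [[|m] x ms|[|m] ms].
- by case: (gd x).
- by rewrite derive1Sn g'E; exact: g'd.
- by move=> x; apply: is_derive1_continuous (gd x).
- by rewrite derive1Sn g'E; exact: g'c.
Qed.

Lemma class_C1W (R : realType) (s : nat) (g : R -> R) :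
  class_C1 s.+1 g -> class_C1 s g.
Proof.
by case=> gd gc; split=> m *; [apply: gd; exact: ltnW|apply: gc; exact: ltnW].
Qed.

Lemma class_C1_cst (R : realType) (s : nat) (c : R) :
  class_C1 s (fun=> c : R).
Proof.
elim: s c => [|s IH] c; first by split=> [//|[|//] _ x]; exact: cvg_cst.
by apply/class_C1SP; exists (fun=> 0) => [x|]; [exact: is_derive_cst|exact: IH].
Qed.

Lemma class_C1D (R : realType) (s : nat) (g h : R -> R) :
  class_C1 s g -> class_C1 s h -> class_C1 s (fun x => g x + h x).
Proof.
elim: s g h => [|s IH] g h.
  move=> [_ /(_ 0%N isT) gc] [_ /(_ 0%N isT) hc].
  by split=> [//|[|//] _ x]; exact: cvgD (gc x) (hc x).
move=> /class_C1SP[g' gd g's] /class_C1SP[h' hd h's].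
apply/class_C1SP; exists (fun x => g' x + h' x) => [x|]; last exact: IH.
exact: (@is_deriveD R R R).
Qed.

(** The outer factor [a] absorbs the constant produced by the chain rule, so the derivative has the
    same shape and the induction closes. *)
Lemma class_C1_affine (R : realType) (s : nat) (a b c : R) (g : R -> R) :
  class_C1 s g -> class_C1 s (fun x => a * g (c * x + b)).
Proof.
elim: s a g => [|s IH] a g.
  move=> [_ /(_ 0%N isT) gc]; split=> [//|[|//] _ x].
  apply: cvgM; first exact: cvg_cst.
  apply: (@continuous_comp R R R (fun y => c * y + b) g); last exact: gc.
  apply: cvgD; last exact: cvg_cst.
  by apply: cvgM; [exact: cvg_cst|exact: cvg_id].
move=> /class_C1SP[g' gd g's]; apply/class_C1SP.
exists (fun x => (a * c) * g' (c * x + b)) => [x|]; last exact: IH.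
have hd := is_derive_affine _ _ b c x _ (gd (c * x + b)).
rewrite -mulrA [c * _]mulrC.
exact: (@is_deriveZ R R R (fun y => g (c * y + b)) a x 1 _ hd).
Qed.

Lemma class_C1_sum (R : realType) (s : nat) (I : Type) (r : seq I)
    (P : pred I) (g : I -> R -> R) :
  (forall i, P i -> class_C1 s (g i)) ->
  class_C1 s (fun x => \sum_(i <- r | P i) g i x).
Proof.
move=> gs; elim: r => [|i r IH].
  by under eq_fun do rewrite big_nil; exact: class_C1_cst.
under eq_fun do rewrite big_cons.
by case Pi: (P i) => //; exact: class_C1D (gs _ Pi) IH.
Qed.

(** * Antiderivatives and Riemann sums *)

Lemma continuous_segment_integrable (R : realType) (g : R -> R) (a b : R) :
  continuous g -> lebesgue_measure.-integrable `[a, b] (EFin \o g).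
Proof.
move=> gc; apply: continuous_compact_integrable; first exact: segment_compact.
exact: continuous_subspaceT.
Qed.

Lemma antiderivative_exists (R : realType) (g : R -> R) :
  continuous g -> exists G : R -> R, forall x : R, is_derive x 1 G (g x).
Proof.
move=> gc; pose P a x := \int[lebesgue_measure]_(t in `[a, x]) g t.
have PE a b x : a <= b -> b <= x ->
    P a x = P a b + \int[lebesgue_measure]_(t in `]b, x]) g t.
  move=> ab bx; rewrite /P -(@Rintegral_itvB _ g (BLeft a) (BRight x) b).
  - by rewrite addrC subrK.
  - exact: continuous_segment_integrable.
  - by rewrite bnd_simp.
  - by rewrite bnd_simp.
have PB a b x y : a <= b -> b <= x -> b <= y -> P a x - P a y = P b x - P b y.
  move=> ab bx by_; rewrite (PE a b x)// (PE a b y)// (PE b b x)// (PE b b y)//.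
  ring.
(* The integral over [[a, x]] is the right one only when [a <= x], so the base point is moved to the
   left of both [x] and 0. By [PB] the difference does not depend on the base point. *)
exists (fun x => P (Num.min x 0 - 1) x - P (Num.min x 0 - 1) 0) => x.
(* This base point is admissible for every [y] within distance 1 of [x], so near [x] the function
   has a fixed base point and the fundamental theorem applies. *)
set a := Num.min x 0 - 2.
have ax : a < x by rewrite /a; case: (leP x 0) => ?; lra.
have a0 : a <= 0 by rewrite /a; case: (leP x 0) => ?; lra.
have [dP P'] := @continuous_FTC1_closed _ g a x (x + 1) ltac:(lra)
  (continuous_segment_integrable _ _ _ _ gc) ax (gc x).
have dPx : is_derive x 1 (fun y => P a y - P a 0) (g x).
  apply: is_derive_eq; first by apply: is_deriveB; apply: DeriveDef; [exact: dP|].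
  by rewrite subr0 -derive1E P'.
apply: near_eq_is_derive dPx; near=> y.
have xy : x - 1 < y < x + 1.
  have : y \in `]x - 1, x + 1[.
    by near: y; apply: near_in_itvoo; rewrite in_itv/=; lra.
  by rewrite in_itv.
by apply: PB; rewrite /a; case: (leP x 0) => ?; case: (leP y 0) => ?; lra.
Unshelve. all: by end_near. Qed.

Lemma Rintegral_FTC2 (R : realType) (g G : R -> R) (a b : R) : a < b ->
  continuous g -> (forall x : R, is_derive x 1 G (g x)) ->
  \int[lebesgue_measure]_(t in `[a, b]) g t = G b - G a.
Proof.
move=> ab gc Gd; rewrite /Rintegral (@continuous_FTC2 R g G a b)//.
- exact: continuous_subspaceT.
- have Gc x : {for x, continuous G} by exact: is_derive1_continuous (Gd x).
  split=> [x _|//|//]; first by case: (Gd x).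
  + by apply: cvg_at_right_filter; exact: Gc.
  + by apply: cvg_at_left_filter; exact: Gc.
- by move=> x _; rewrite derive1E derive_val.
Qed.

(** [G 1 - G 0] telescopes over the grid, and the mean value theorem turns each increment into a
    value of [g] divided by the grid size. Uniform continuity of [g] on the unit segment compares
    that value with the one at the left node. *)
Lemma riemann_sum_cvg (R : realType) (g G : R -> R) :
  continuous g -> (forall x : R, is_derive x 1 G (g x)) ->
  n%:R^-1 * \sum_(j < n) g (j%:R / n%:R) @[n --> \oo] --> G 1 - G 0.
Proof.
move=> gc Gd; rewrite -cvg_shiftS; apply/cvgrPdist_le => e e0.
(* Uniform continuity, from compactness of the segment: one neighbourhood of 0 for the increment [d]
   serves all [x]. *)
have unif : \forall d \near (0 : R), `[0, 1] `<=`
    (fun x : R => `|g (x + d) - g x| <= e).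
  apply: (proj1 (compact_near_coveringP _) (@segment_compact R 0 1) R (nbhs 0)
    (fun d x => `|g (x + d) - g x| <= e)) => x _.
  have : {for (x, 0), continuous (fun p : R * R => g (p.1 + p.2) - g p.1)}.
    apply: cvgB.
      apply: (@continuous_comp _ _ _ (fun p : R * R => p.1 + p.2) g).
        exact: add_continuous.
      exact: gc.
    apply: (@continuous_comp _ _ _ (fun p : R * R => p.1) g); last exact: gc.
    exact: cvg_fst.
  rewrite /prop_for /continuous_at /= addr0 subrr => /cvgr0_norm_le/(_ e e0).
  exact.
have [d /= d0 dP] := unif.
near=> n.
have : (n.+1%:R : R)^-1 < d.
  by near: n; exact: (near_infty_natSinv_lt (PosNum d0)).
set N : R := n.+1%:R => Nd; have N0 : 0 < N by rewrite ltr0n.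
have -> : G 1 - G 0 = \sum_(j < n.+1) (G (j.+1%:R / N) - G (j%:R / N)).
  rewrite -(big_mkord xpredT (fun j => G (j.+1%:R / N) - G (j%:R / N))).
  by rewrite (telescope_sumr (fun j => G (j%:R / N)))// mul0r divff// gt_eqF.
rewrite mulr_sumr -sumrB (le_trans (ler_norm_sum _ _ _))//.
have -> : e = \sum_(j < n.+1) e / N.
  by rewrite sumr_const card_ord -[_ *+ n.+1]mulr_natr -/N mulfVK// gt_eqF.
apply: ler_sum => j _.
have jj : j%:R / N < j.+1%:R / N by rewrite ltr_pM2r ?invr_gt0// ltr_nat.
have [c] := @MVT R G g _ _ jj (fun x _ => Gd x)
  (continuous_subspaceT (fun x => is_derive1_continuous _ _ _ _ (Gd x))).
have -> : j.+1%:R / N - j%:R / N = N^-1 by rewrite -mulrBl -natrB// subSnn mul1r.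
rewrite in_itv/= => /andP[jc cj] ->.
rewrite [N^-1 * _]mulrC -mulrBl normrM (gtr0_norm (_ : 0 < N^-1)) ?invr_gt0//.
rewrite ler_pM2r ?invr_gt0//.
have := dP (c - j%:R / N); rewrite /= sub0r normrN => /(_ _ (j%:R / N)).
rewrite addrCA subrr addr0; apply.
  rewrite gtr0_norm ?subr_gt0//; apply: lt_trans Nd.
  by rewrite ltrBlDl (lt_le_trans cj)// -natr1 mulrDl mul1r.
rewrite /= in_itv/= divr_ge0 ?ler0n//= ler_pdivrMr// mul1r.
by rewrite ler_nat ltnW// ltnW.
Unshelve. all: by end_near. Qed.

(** * Averages over rational grids *)

(** At the point [(x - beta_k h, h)] the i-th summand has argument [x + c_i h], whence the step
    [c]. *)
Definition grid_average (R : realType) (phi : rat -> R) (c t : rat) (n : nat) : R :=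
  n%:R^-1 * \sum_(j < n) phi (t + c * (j%:R / n%:R)).

Lemma cvg_factorial : (fun n : nat => n`!) n @[n --> \oo] --> \oo.
Proof.
apply/cvgnyPge => A; near=> n; rewrite (@leq_trans n)//; last exact: fact_geq.
by near: n; exact: nbhs_infty_ge.
Unshelve. all: by end_near. Qed.

(** Splitting the sum over [m + n] terms after [m] or after [n] terms gives the identity. It
    exchanges the length of the sum with the length of the shift. *)
Lemma sum_shift_sub (V : zmodType) (F : nat -> V) (m n : nat) :
  \sum_(j < n) F (j + m)%N - \sum_(j < n) F j =
  \sum_(j < m) (F (j + n)%N - F j).
Proof.
have E p q : \sum_(j < p + q) F j =
    \sum_(j < p) F j + \sum_(j < q) F (j + p)%N.
  by rewrite big_split_ord; congr (_ + _); apply: eq_bigr => j _; rewrite /= addnC.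
apply/eqP; rewrite sumrB subr_eq addrAC eq_sym subr_eq.
by rewrite ![_ + \sum_(j < _) F j]addrC -!E addnC.
Qed.

(* The grid size is [n`!] because every fixed denominator eventually divides it,
   so that a single sequence of grids serves all rational points at once. *)
Section grid_average_increment.
Variables (R : realType) (phi : rat -> R) (psi Psi : R -> R) (c : rat).
Hypotheses (c0 : c != 0) (psi_cont : continuous psi).
Hypothesis Psi_psi : forall x : R, is_derive x 1 Psi (psi x).
Hypothesis phi_psi : forall t, phi (t + c) - phi t = psi (ratr t).

(** Once [q] divides [N = n!], translation by [c * l] is a shift by [L = l * N] whole grid steps.
    After the exchange in [sum_shift_sub] there remain [L] increments over [N] steps, that is over
    exactly [c], and these are values of [psi]. *)
Let grid_average_increment_nat (t : rat) (p q : nat) : (0 < q)%N ->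
  grid_average R phi c (t + c * (p%:R / q%:R)) n`! - grid_average R phi c t n`!
    @[n --> \oo] -->
  (Psi (ratr (t + c * (p%:R / q%:R))) - Psi (ratr t)) / ratr c.
Proof.
move=> q0; set l : rat := p%:R / q%:R.
have cR : ratr c != 0 :> R by rewrite fmorph_eq0.
case: (posnP p) => [p0|p0].
  rewrite /l p0 mul0r mulr0 addr0 subrr mul0r.
  by under eq_fun do rewrite subrr; exact: cvg_cst.
have l0 : l != 0 by rewrite mulf_neq0 ?invr_eq0 ?pnatr_eq0 -?lt0n.
pose d : R := ratr c * ratr l.
have d0 : d != 0 by rewrite mulf_neq0// fmorph_eq0.
(* [psi] along the segment from [t] to [t + c * l], parametrised by the unit interval, and its
   antiderivative. Dividing by [d] is why [p = 0] was treated apart. *)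
pose eta (h : R) := psi (d * h + ratr t).
pose E (h : R) := d^-1 * Psi (d * h + ratr t).
have eta_cont : continuous eta.
  move=> h; apply: (@continuous_comp R R R (fun y => d * y + ratr t) psi).
    apply: cvgD; last exact: cvg_cst.
    by apply: cvgM; [exact: cvg_cst|exact: cvg_id].
  exact: psi_cont.
have E_eta h : is_derive h (1 : R) E (eta h).
  have hd := is_derive_affine _ _ _ _ _ _ (Psi_psi (d * h + ratr t)).
  rewrite -[eta h](mulfK d0) mulrC.
  exact: (@is_deriveZ R R R (fun y => Psi (d * y + ratr t)) d^-1 h 1 _ hd).
have -> : (Psi (ratr (t + c * l)) - Psi (ratr t)) / ratr c =
    ratr l * (E 1 - E 0).
  rewrite /E mulr1 mulr0 add0r (_ : d + ratr t = ratr (t + c * l)); last first.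
    by rewrite rmorphD rmorphM addrC.
  by rewrite /d; field; rewrite !fmorph_eq0 l0.
(* The number [L] of nodes tends to infinity, so the Riemann sums of [eta] may be taken along it. *)
have Lcvg : (n`! %/ q * p)%N @[n --> \oo] --> \oo.
  apply/cvgnyPge => A; near=> n.
  rewrite (@leq_trans (n`! %/ q))//; last exact: leq_pmulr.
  rewrite leq_divRL// (@leq_trans n)//; last exact: fact_geq.
  by near: n; exact: nbhs_infty_ge.
have S := cvg_comp _ _ Lcvg (riemann_sum_cvg _ _ _ eta_cont E_eta).
have : ratr l * (n%:R^-1 * \sum_(j < n) eta (j%:R / n%:R))
    @[n --> (n`! %/ q * p)%N @[n --> \oo]] --> ratr l * (E 1 - E 0).
  by apply: cvgM; [exact: cvg_cst|exact: S].
apply: cvg_trans; apply: near_eq_cvg; near=> n => /=.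
have qn : (q %| n`!)%N by apply: dvdn_fact; rewrite q0/=; near: n; exact: nbhs_infty_ge.
set N := n`!; set L := (N %/ q * p)%N.
have NE : N = (N %/ q * q)%N by rewrite divnK.
have N0 : (0 < N)%N by exact: fact_gt0.
have Nr : N%:R != 0 :> rat by rewrite pnatr_eq0 -lt0n.
have M0 : (0 < N %/ q)%N by rewrite divn_gt0// dvdn_leq.
have LN : L%:R = l * N%:R :> rat.
  rewrite /L /l natrM [in RHS]NE natrM; field; by rewrite pnatr_eq0 -lt0n.
rewrite /grid_average -mulrBr.
pose F j := phi (t + c * (j%:R / N%:R)).
have -> : \sum_(j < N) phi (t + c * l + c * (j%:R / N%:R)) =
    \sum_(j < N) F (j + L)%N.
  by apply: eq_bigr => j _; rewrite /F natrD LN; congr phi; field.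
rewrite (sum_shift_sub R F).
rewrite mulrA; congr (_ * _).
  have -> : L%:R = ratr l * N%:R :> R.
    by rewrite -[N%:R](ratr_nat R) -[RHS]rmorphM -LN rmorph_nat.
  by field; rewrite !fmorph_eq0 ?l0 ?pnatr_eq0 -?lt0n ?N0.
apply: eq_bigr => j _.
have -> : F (j + N)%N = phi (t + c * (j%:R / N%:R) + c).
  by rewrite /F natrD; congr phi; field.
rewrite phi_psi /eta; congr psi.
rewrite addrC rmorphD rmorphM; congr (_ + _); rewrite /d -mulrA; congr (_ * _).
rewrite -(ratr_nat R L) -(ratr_nat R j) -fmorph_div -rmorphM; congr ratr.
by rewrite LN; field; rewrite ?l0 ?Nr.
Unshelve. all: by end_near. Qed.

Lemma grid_average_increment (t t' : rat) :
  grid_average R phi c t' n`! - grid_average R phi c t n`! @[n --> \oo] -->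
  (Psi (ratr t') - Psi (ratr t)) / ratr c.
Proof.
have [l lE] : exists l : rat, t' = t + c * l.
  by exists ((t' - t) / c); rewrite mulrCA divff// mulr1 addrCA subrr addr0.
have [p [q [q0 pq]]] : exists p q : nat, (0 < q)%N /\ `|l| = p%:R / q%:R.
  exists `|numq l|%N, `|denq l|%N; split; first by rewrite absz_gt0 denq_eq0.
  rewrite -[in LHS](divq_num_den l) normrM normfV -!intr_norm.
  by rewrite -!abszE.
have [l0|l0] := leP 0 l.
  by rewrite lE -(ger0_norm l0) pq; exact: grid_average_increment_nat.
(* For negative [l] the two points exchange roles. *)
have -> : t = t' + c * (p%:R / q%:R).
  by rewrite -pq lE ltr0_norm// mulrN addrK.
rewrite -[_ - Psi (ratr (t' + _))]opprB mulNr.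
under eq_fun do rewrite -opprB.
by apply: cvgN; exact: grid_average_increment_nat.
Qed.

End grid_average_increment.

(** * Smoothness in the first variable and integrals with a parameter *)

(* Only smoothness in the first variable is tracked: the directions of the
   summands are (1, beta_i), and each summand is recovered along the first axis. *)
Fixpoint class_C1x (R : realType) (s : nat) (F : R * R -> R) : Prop :=
  continuous F /\
  match s with
  | 0%N => True
  | s'.+1 => exists2 F' : R * R -> R,
      forall x y : R, is_derive x 1 (fun z => F (z, y)) (F' (x, y)) &
      class_C1x R s' F'
  end.

Lemma continuous_pair (T U V : topologicalType) (f : T -> U) (g : T -> V) :
  continuous f -> continuous g -> continuous (fun x => (f x, g x)).
Proof. by move=> fc gc x; apply: cvg_pair; [exact: fc|exact: gc]. Qed.

Lemma class_C1x_continuous (R : realType) (s : nat) (F : R * R -> R) :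
  class_C1x R s F -> continuous F.
Proof. by case: s => [|s] []. Qed.

Lemma class_C1x_sub_shift (R : realType) (s : nat) (a b : R) (F : R * R -> R) :
  class_C1x R s F -> class_C1x R s (fun p => F (p.1 + a, p.2 + b) - F p).
Proof.
have shiftc (G : R * R -> R) : continuous G ->
    continuous (fun p : R * R => G (p.1 + a, p.2 + b) - G p).
  move=> Gc; suff Gabc : continuous (fun p : R * R => G (p.1 + a, p.2 + b)).
    by move=> p; exact: (@continuousB R R _ _ _ _ (Gabc p) (Gc p)).
  move=> p; apply: (@continuous_comp _ _ _ (fun p : R * R => (p.1 + a, p.2 + b)) G).
    apply: (@continuous_pair _ R R) => q.
      by apply: (@cvgD R R); [exact: cvg_fst|exact: cvg_cst].
    by apply: (@cvgD R R); [exact: cvg_snd|exact: cvg_cst].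
  exact: Gc.
elim: s F => [|s IH] F [Fc]; first by split=> //; exact: shiftc.
move=> [F' Fd F's]; split; first exact: shiftc.
exists (fun p => F' (p.1 + a, p.2 + b) - F' p); last exact: IH.
move=> x y /=; have := Fd (x + a) (y + b); rewrite -{1}[x]mul1r => Fdx.
have := is_derive_affine _ _ _ _ _ _ Fdx.
rewrite mulr1; under eq_fun do rewrite mul1r.
by move=> hd; apply: (@is_deriveB R R R).
Qed.

Section parametric_integral.
Variables (R : realType) (H : R * R -> R).
Hypothesis Hc : continuous H.
Notation I01 := (`[0, 1]%classic : set R).

Let slice_continuous (x : R) : continuous (fun y => H (x, y)).
Proof.
move=> y; apply: (@continuous_comp _ _ _ (fun y => (x, y)) H); last exact: Hc.
by apply: (@continuous_pair R R R) => z; [exact: cvg_cst|exact: cvg_id].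
Qed.

Lemma rectangle_bound (a b c d : R) : exists M : R, forall x y,
  a <= x <= b -> c <= y <= d -> `|H (x, y)| <= M.
Proof.
have /compact_bounded[M [_ HM]] : compact (H @` (`[a, b] `*` `[c, d])).
  apply: continuous_compact; first exact: continuous_subspaceT.
  by apply: compact_setX; exact: segment_compact.
exists (M + 1) => x y xab ycd; apply: (HM (M + 1)); first by rewrite ltrDl.
by exists (x, y) => //; split; rewrite /= in_itv.
Qed.

Lemma parametric_integral_continuous :
  continuous (fun x => \int[lebesgue_measure]_(y in I01) H (x, y)).
Proof.
move=> a.
have [M HM] := rectangle_bound (a - 1) (a + 1) 0 1.
apply: (@continuity_under_integral R _ _ lebesgue_measure
  (fun x y => H (x, y)) I01 _ (a - 1) (a + 1) _ _ (fun=> M)) => //.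
- by move=> x _; exact: continuous_segment_integrable.
- apply: aeW => y _ x _.
  apply: (@continuous_comp _ _ _ (fun x => (x, y)) H); last exact: Hc.
  by apply: (@continuous_pair R R R) => z; [exact: cvg_id|exact: cvg_cst].
- by apply: continuous_segment_integrable => x; exact: cvg_cst.
- move=> x; rewrite /= in_itv/= => /andP[ax xa]; apply: aeW => y.
  by rewrite /= in_itv/= => y01; apply: HM => //; rewrite !ltW.
- by apply/mem_set; rewrite /= in_itv/=; lra.
Qed.

End parametric_integral.

(** Differentiation under the integral sign; near [a] the derivative is dominated by a constant, its
    bound on a compact rectangle. *)
Lemma is_derive_parametric_integral (R : realType) (H H' : R * R -> R) (a : R) :
  continuous H -> continuous H' ->
  (forall x y : R, is_derive x 1 (fun z => H (z, y)) (H' (x, y))) ->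
  is_derive a 1 (fun x => \int[lebesgue_measure]_(y in `[0, 1]) H (x, y))
    (\int[lebesgue_measure]_(y in `[0, 1]) H' (a, y)).
Proof.
move=> Hc H'c Hd.
have [M HM] := rectangle_bound _ _ H'c (a - 1) (a + 1) 0 1.
have slicec K : continuous K -> forall x, continuous (fun y : R => K (x : R, y) : R).
  move=> Kc x y; apply: (@continuous_comp _ _ _ (fun y => (x, y)) K); last exact: Kc.
  by apply: (@continuous_pair R R R) => z; [exact: cvg_cst|exact: cvg_id].
have E x y : partial1of2 (fun x y => H (x, y)) x y = H' (x, y).
  by rewrite partial1of2E derive_val.
have aI : `]a - 1, a + 1[%classic a by rewrite /= in_itv/=; lra.
have intH x : `]a - 1, a + 1[%classic x ->
    lebesgue_measure.-integrable `[0, 1] (EFin \o (fun y => H (x, y))).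
  by move=> _; apply: continuous_segment_integrable; exact: slicec.
have dH x y : `]a - 1, a + 1[%classic x -> `[0, 1]%classic y ->
    derivable ((fun x y => H (x, y))^~ y) x 1.
  by move=> _ _; case: (Hd x y).
have M0 : 0 <= M by rewrite (le_trans _ (HM a 0 _ _))//; lra.
have intM : lebesgue_measure.-integrable `[0, 1] (EFin \o (fun=> M : R)).
  by apply: continuous_segment_integrable => x; exact: cvg_cst.
have ub x y : `]a - 1, a + 1[%classic x -> `[0, 1]%classic y ->
    `|partial1of2 (fun x y => H (x, y)) x y| <= M.
  rewrite /= !in_itv/= E => /andP[ax xa] y01.
  by apply: HM => //; rewrite !ltW.
apply: DeriveDef.
  by apply: (derivable_under_integral _ aI intH dH _ intM ub).
rewrite -derive1E (differentiation_under_integral _ aI intH dH _ intM ub)//.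
by under eq_Rintegral do rewrite E.
Qed.

(** The shear is differentiated in [x] with [h] fixed, so only the first partial derivative of [F]
    appears and the induction stays inside [class_C1x]. *)
Lemma class_C1_integral (R : realType) (s : nat) (b : R) (F : R * R -> R) :
  class_C1x R s F ->
  class_C1 s (fun x => \int[lebesgue_measure]_(h in `[0, 1]) F (x + b * h, h)).
Proof.
have skewc (G : R * R -> R) : continuous G ->
    continuous (fun p : R * R => G (p.1 + b * p.2, p.2)).
  move=> Gc p.
  apply: (@continuous_comp _ _ _ (fun p : R * R => (p.1 + b * p.2, p.2)) G).
    apply: (@continuous_pair _ R R) => q; last exact: cvg_snd.
    apply: (@cvgD R R); first exact: cvg_fst.
    by apply: cvgM; [exact: cvg_cst|exact: cvg_snd].
  exact: Gc.
elim: s F => [|s IH] F [Fc].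
  move=> _; split=> [//|[|//] _].
  exact: (parametric_integral_continuous _ _ (skewc _ Fc)).
move=> [F' Fd F's]; apply/class_C1SP.
exists (fun x => \int[lebesgue_measure]_(h in `[0, 1]) F' (x + b * h, h)).
  move=> a.
  apply: (is_derive_parametric_integral _ _ _ _ (skewc _ Fc)
    (skewc _ (class_C1x_continuous _ _ _ F's))) => x h /=.
  have := Fd (x + b * h) h; rewrite -{1}[x]mul1r => Fdx.
  have := is_derive_affine _ _ _ _ _ _ Fdx.
  by rewrite mulr1; under eq_fun do rewrite mul1r.
exact: IH.
Qed.

Lemma skew_average_cvg (R : realType) (b : R) (F : R * R -> R) (x : R) :
  continuous F ->
  n`!%:R^-1 * \sum_(j < n`!) F (x + b * (j%:R / n`!%:R), j%:R / n`!%:R)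
    @[n --> \oo] -->
  \int[lebesgue_measure]_(h in `[0, 1]) F (x + b * h, h).
Proof.
move=> Fc; pose eta (h : R) := F (x + b * h, h).
have eta_cont : continuous eta.
  move=> h; apply: (@continuous_comp R _ R (fun h => (x + b * h, h)) F).
    apply: (@continuous_pair R R R) => z; last exact: cvg_id.
    apply: (@cvgD R R); first exact: cvg_cst.
    by apply: cvgM; [exact: cvg_cst|exact: cvg_id].
  exact: Fc.
have [E E_eta] := antiderivative_exists _ _ eta_cont.
rewrite (Rintegral_FTC2 _ _ _ _ _ ltr01 eta_cont E_eta).
exact: (cvg_comp _ _ cvg_factorial (riemann_sum_cvg _ _ _ eta_cont E_eta)).
Qed.

(** * Ridge sums in the plane with rational slopes *)

(** The sum runs over a subset [A] of a fixed index type, so that the induction on its cardinality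
    drops [k] while [beta] stays the same; [phi] and [F] vary, being replaced by their
    differences. *)
Lemma plane_ridge_summand (R : realType) (s : nat) (I : finType)
    (beta : I -> rat) (A : {set I}) (phi : I -> rat -> R) (F : R * R -> R) :
  injective beta -> class_C1x R s F ->
  (forall x y : rat, F (ratr x, ratr y) = \sum_(i in A) phi i (x + beta i * y)) ->
  forall k, k \in A ->
  exists2 g, class_C1 s g & forall t : rat, phi k t = g (ratr t).
Proof.
move=> beta_inj; have [m] := ubnP #|A|.
elim: m A phi F => // m IH A phi F Am Fs FE k kA.
(* The direction (- beta k, 1) annihilates the k-th summand and shifts the
   argument of the i-th one by c i. *)
pose c i := beta i - beta k.
have AkA : (#|A :\ k| < m)%N by move: Am; rewrite (cardsD1 k A) kA.
have /choice[Psi PsiP] : forall i, exists Psi : R -> R, i \in A :\ k ->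
    exists psi : R -> R, [/\ class_C1 s psi,
      forall t, phi i (t + c i) - phi i t = psi (ratr t) &
      forall x : R, is_derive x 1 Psi (psi x)].
  move=> i; have [iA|iA] := boolP (i \in A :\ k); last first.
    by exists (fun=> 0) => iA'; case/negP: iA.
  have DF (x y : rat) :
      F (ratr x + ratr (- beta k), ratr y + 1) - F (ratr x, ratr y) =
      \sum_(i in A :\ k)
        (phi i (x + beta i * y + c i) - phi i (x + beta i * y)).
    rewrite -rmorphD -(rmorph1 ratr) -(rmorphD ratr y 1) !FE -sumrB.
    rewrite (big_setD1 k)//= [X in X + _](_ : _ = 0) ?add0r; last first.
      by rewrite (_ : x - beta k + _ = x + beta k * y) ?subrr//; ring.
    apply: eq_bigr => j _; congr (phi j _ - _); rewrite /c; ring.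
  have [psi psis psiE] := IH _ (fun i t => phi i (t + c i) - phi i t) _ AkA
    (class_C1x_sub_shift _ _ (ratr (- beta k)) 1 _ Fs) DF i iA.
  have [Psi Psid] := antiderivative_exists _ _ (class_C1_continuous _ _ _ psis).
  by exists Psi => _; exists psi.
pose Fbar (x : R) :=
  \int[lebesgue_measure]_(h in `[0, 1]) F (x + ratr (- beta k) * h, h).
have Fbars : class_C1 s Fbar by exact: class_C1_integral.
(* The k-th summand is constant along [(- beta k, 1)], so it comes out of the average as
   [phi k x]. *)
have avg (x : rat) : phi k x + \sum_(i in A :\ k) grid_average R (phi i) (c i) x n`!
    @[n --> \oo] --> Fbar (ratr x).
  have := skew_average_cvg _ (ratr (- beta k)) F (ratr x)
    (class_C1x_continuous _ _ _ Fs).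
  rewrite -/(Fbar _); apply: cvg_trans; apply: near_eq_cvg; near=> n.
  set N := n`!; have N0 : N%:R != 0 :> R by rewrite pnatr_eq0 -lt0n fact_gt0.
  rewrite /grid_average -mulr_sumr.
  have -> : phi k x = N%:R^-1 * \sum_(j < N) phi k x.
    by rewrite sumr_const card_ord -[phi k x *+ N]mulr_natl mulrA mulVf// mul1r.
  rewrite -mulrDr exchange_big -big_split/=; congr (_ * _).
  apply: eq_bigr => j _.
  rewrite -(ratr_nat R j) -(ratr_nat R N) -fmorph_div -rmorphM -rmorphD FE.
  rewrite (big_setD1 k)//=; congr (phi k _ + _); first by ring.
  by apply: eq_bigr => i _; congr (phi i _); rewrite /c; ring.
(* The constant makes the candidate equal to [phi k] at 0. *)
pose C := phi k 0 - Fbar 0 + \sum_(i in A :\ k) Psi i 0 / ratr (c i).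
exists (fun x => Fbar x + (\sum_(i in A :\ k) - (ratr (c i))^-1 * Psi i x + C)).
  apply: class_C1D => //; apply: class_C1D; last exact: class_C1_cst.
  apply: class_C1_sum => i /PsiP[psi [psis _ Psid]].
  have Psis : class_C1 s (Psi i) by apply: class_C1W; apply/class_C1SP; exists psi.
  have := class_C1_affine _ _ (- (ratr (c i))^-1) 0 1 _ Psis.
  by under eq_fun do rewrite mul1r addr0.
move=> t.
(* Both sides are limits of the one sequence [D]. Increments are used because convergence of the
   single averages is not known here. *)
have inc : phi k t - phi k 0 +
    \sum_(i in A :\ k) (Psi i (ratr t) - Psi i (ratr 0)) / ratr (c i) =
    Fbar (ratr t) - Fbar (ratr 0).
  pose D n := phi k t - phi k 0 + \sum_(i in A :\ k)
    (grid_average R (phi i) (c i) t n`! - grid_average R (phi i) (c i) 0 n`!).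
  apply: (@cvg_unique _ _ (D n @[n --> \oo])) => //.
    apply: cvgD; first exact: cvg_cst.
    apply: cvg_big => [|i iA]; first exact: add_continuous.
    have [psi [psis psiE Psid]] := PsiP i iA.
    apply: (grid_average_increment _ _ psi) => //.
      rewrite /c subr_eq0; apply/eqP => /beta_inj ik.
      by move: iA; rewrite ik !inE eqxx.
    exact: class_C1_continuous psis.
  apply: cvg_trans (cvgB (avg t) (avg 0)).
  by apply: near_eq_cvg; apply: nearW => n; rewrite /D sumrB !fctE; ring.
rewrite /C; move: inc; rewrite rmorph0.
under eq_bigr do rewrite mulrBl.
rewrite sumrB => inc.
have -> : \sum_(i in A :\ k) - (ratr (c i))^-1 * Psi i (ratr t) =
    - \sum_(i in A :\ k) Psi i (ratr t) / ratr (c i).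
  by rewrite -sumrN; apply: eq_bigr => i _; rewrite mulNr mulrC.
lra.
Unshelve. all: by end_near. Qed.

(** * Directional derivatives in several variables *)

Lemma is_derive_line (R : realType) (n : nat) (f : 'rV[R]_n -> R)
    (x v : 'rV[R]_n) (t d : R) :
  is_derive (x + t *: v) v f d -> is_derive t 1 (fun t => f (x + t *: v)) d.
Proof.
have E : (fun h : R => h^-1 *: (((fun t => f (x + t *: v)) \o shift t) (h *: 1)
      - f (x + t *: v))) =
    (fun h : R => h^-1 *: ((f \o shift (x + t *: v)) (h *: v) - f (x + t *: v))).
  apply/funext => h; congr (_ *: (f _ - _)) => /=.
  by rewrite [h *: 1]mulr1 scalerDl addrCA.
by case=> fd fE; split; [rewrite /derivable E|rewrite -fE /derive E].
Qed.

Lemma partial_MVT (R : realType) (n : nat) (f D : 'rV[R]_n -> R)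
    (v : 'rV[R]_n) (x : 'rV[R]_n) (t : R) :
  (forall x, is_derive x v f (D x)) ->
  exists2 th : R, `|th| <= `|t| & f (x + t *: v) - f x = t * D (x + th *: v).
Proof.
move=> fd; pose q (t : R) := f (x + t *: v).
have qd (s : R) : is_derive s 1 q (D (x + s *: v)) by exact: is_derive_line.
have qc a b : {within `[a, b], continuous q}.
  by apply: continuous_subspaceT => s; exact: is_derive1_continuous (qd s).
have -> : f x = q 0 by rewrite /q scale0r addr0.
rewrite -[f _]/(q t); have [t0|t0] := leP 0 t.
  have [th] := MVT_segment t0 (fun s _ => qd s) (qc _ _).
  rewrite in_itv/= subr0 => /andP[th0 tht] ->; exists th; last by rewrite mulrC.
  by rewrite !ger0_norm.
have [th] := MVT_segment (ltW t0) (fun s _ => qd s) (qc _ _).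
rewrite in_itv/= => /andP[tht th0] qE; exists th.
  by rewrite !ler0_norm// ?lerN2// ltW.
by rewrite -opprB qE sub0r mulrN opprK mulrC.
Qed.

(** The increment is split into a move along [v] and then one along [e]. The mean value theorem
    evaluates the second at a point tending to [x], where [D] is continuous. *)
Lemma is_derive_add_partial (R : realType) (n : nat) (f D : 'rV[R]_n -> R)
    (v e x : 'rV[R]_n) (c l : R) :
  (forall x, is_derive x e f (D x)) -> continuous D ->
  is_derive x v f l -> is_derive x (v + c *: e) f (l + c * D x).
Proof.
move=> fd Dc [fv fvE].
suff H : h^-1 *: ((f \o shift x) (h *: (v + c *: e)) - f x) @[h --> 0^'] -->
    l + c * D x.
  by apply: DeriveDef; [apply/cvg_ex; exists (l + c * D x)|exact: cvg_lim].
have /choice[th thP] : forall h : R, exists th : R, `|th| <= `|h * c| /\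
    f (x + h *: v + (h * c) *: e) - f (x + h *: v) =
    (h * c) * D (x + h *: v + th *: e).
  by move=> h; have [th] := partial_MVT _ _ _ _ _ (x + h *: v) (h * c) fd; exists th.
have th0 : th h @[h --> (0 : R)] --> (0 : R).
  apply: norm_cvg0; apply: (@squeeze_cvgr _ _ _ _ (cst 0) (fun h => `|h * c|)).
  - by apply: nearW => h; rewrite /= normr_ge0/=; case: (thP h).
  - exact: cvg_cst.
  - have : `|h * c| @[h --> (0 : R)] --> `|0 * c|.
      by apply: cvg_norm; apply: cvgM; [exact: cvg_id|exact: cvg_cst].
    by rewrite mul0r normr0.
have z0 : x + h *: v + th h *: e @[h --> (0 : R)] --> x.
  suff : x + h *: v + th h *: e @[h --> (0 : R)] --> x + 0 *: v + 0 *: e.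
    by rewrite !scale0r !addr0.
  apply: cvgD; last by apply: cvgZr_tmp.
  by apply: cvgD; [exact: cvg_cst|apply: cvgZr_tmp; exact: cvg_id].
have D0 : D (x + h *: v + th h *: e) @[h --> 0^'] --> D x.
  apply: cvg_within_filter.
  exact: (cvg_comp _ _ z0 (Dc x)).
have fv' : h^-1 *: ((f \o shift x) (h *: v) - f x) @[h --> 0^'] --> l.
  by rewrite -fvE.
have : h^-1 *: ((f \o shift x) (h *: v) - f x) + c * D (x + h *: v + th h *: e)
    @[h --> 0^'] --> l + c * D x.
  by apply: cvgD => //; apply: cvgM => //; exact: cvg_cst.
apply: cvg_trans; apply: near_eq_cvg; near=> h => /=.
have h0 : h != 0 by near: h; exact: nbhs_dnbhs_neq.
have -> : h *: (v + c *: e) + x = x + h *: v + (h * c) *: e.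
  by rewrite scalerDr scalerA addrC addrA.
have [_ /eqP] := thP h; rewrite subr_eq => /eqP ->.
rewrite (addrC (h *: v) x) /GRing.scale/=; by field.
Unshelve. all: by end_near. Qed.

Lemma class_CnD (R : realType) (n s : nat) (f g : 'rV[R]_n -> R) :
  class_Cn s f -> class_Cn s g -> class_Cn s (fun x => f x + g x).
Proof.
elim: s f g => [|s IH] f g [fc fd] [gc gd]; split=> //.
- by move=> x; exact: cvgD (fc x) (gc x).
- by move=> x; exact: cvgD (fc x) (gc x).
move=> i; have [fdi fi] := fd i; have [gdi gi] := gd i; split=> [x|].
  exact: derivableD.
have -> : (fun x => 'D_('e_i) (fun x => f x + g x) x) =
    (fun x => 'D_('e_i) f x + 'D_('e_i) g x).
  by apply/funext => x; exact: deriveD.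
exact: IH.
Qed.

Lemma class_CnZ (R : realType) (n s : nat) (c : R) (f : 'rV[R]_n -> R) :
  class_Cn s f -> class_Cn s (fun x => c * f x).
Proof.
elim: s f => [|s IH] f [fc fd]; split=> //.
- by move=> x; apply: (@continuousM _ _ (cst c) f); [exact: cst_continuous|exact: fc].
- by move=> x; apply: (@continuousM _ _ (cst c) f); [exact: cst_continuous|exact: fc].
move=> i; have [fdi fi] := fd i; split=> [x|].
  exact: (@derivableZ R _ R f c).
have -> : (fun x => 'D_('e_i) (fun x => c * f x) x) =
    (fun x => c * 'D_('e_i) f x).
  by apply/funext => x; exact: (@deriveZ R _ R f c).
exact: IH.
Qed.

Lemma class_Cn_cst (R : realType) (n s : nat) (c : R) :
  class_Cn s (fun _ : 'rV[R]_n => c).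
Proof.
elim: s c => [|s IH] c; split=> //; try exact: cst_continuous.
move=> i; split=> [x|]; first exact: derivable_cst.
by under eq_fun do rewrite derive_cst; exact: IH.
Qed.

Lemma class_Cn_sum (R : realType) (n s : nat) (I : Type) (r : seq I)
    (f : I -> 'rV[R]_n -> R) :
  (forall i, class_Cn s (f i)) -> class_Cn s (fun x => \sum_(i <- r) f i x).
Proof.
move=> fs; elim: r => [|i r IH].
  by under eq_fun do rewrite big_nil; exact: class_Cn_cst.
by under eq_fun do rewrite big_cons; exact: class_CnD.
Qed.

Lemma class_Cn_continuous (R : realType) (n s : nat) (f : 'rV[R]_n -> R) :
  class_Cn s f -> continuous f.
Proof. by case: s => [|s] []. Qed.

(** The direction is assembled one coordinate at a time from the zero vector, by
    [is_derive_add_partial]. *)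
Lemma class_Cn_directional (R : realType) (n s : nat) (f : 'rV[R]_n -> R)
    (u : 'rV[R]_n) :
  class_Cn s.+1 f -> exists2 D : 'rV[R]_n -> R,
    forall x, is_derive x u f (D x) & class_Cn s D.
Proof.
move=> [_ fd]; exists (fun x => \sum_(i < n) u 0 i * 'D_('e_i) f x); last first.
  by apply: class_Cn_sum => i; apply: class_CnZ; case: (fd i).
move=> x; rewrite {1}(row_sum_delta u).
elim: (index_enum _) => [|i r IH].
  rewrite !big_nil; apply: DeriveDef; first exact: derivable0.
  exact: derive0.
rewrite !big_cons addrC [X in is_derive _ _ _ X]addrC.
apply: (is_derive_add_partial _ _ _ ('D_('e_i) f)) => //.
- by move=> y; apply: DeriveDef => //; case: (fd i).
- by case: (fd i) => _ /class_Cn_continuous.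
Qed.

Lemma class_C1x_plane (R : realType) (n s : nat) (f : 'rV[R]_n -> R)
    (U V : 'rV[R]_n) :
  class_Cn s f -> class_C1x R s (fun p => f (p.1 *: U + p.2 *: V)).
Proof.
have planec (g : 'rV[R]_n -> R) : continuous g ->
    continuous (fun p : R * R => g (p.1 *: U + p.2 *: V)).
  move=> gc p.
  apply: (@continuous_comp _ _ _ (fun p : R * R => p.1 *: U + p.2 *: V) g).
    apply: cvgD; apply: cvgZr_tmp.
      exact: cvg_fst.
    exact: cvg_snd.
  exact: gc.
elim: s f => [|s IH] f fs; first by split=> //; apply: planec; case: fs.
split; first by apply: planec; case: fs.
have [D fD Ds] := class_Cn_directional _ _ _ _ U fs.
exists (fun p => D (p.1 *: U + p.2 *: V)); last exact: IH.
move=> x y /=; under eq_fun do rewrite addrC.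
by apply: is_derive_line; rewrite addrC.
Qed.

(** * Density and genericity of rational vectors *)

Lemma continuous_eq_on_ratvec (R : realType) (n : nat) (f g : 'rV[R]_n -> R) :
  continuous f -> continuous g ->
  (forall q : 'rV[rat]_n, f (map_mx ratr q) = g (map_mx ratr q)) ->
  forall x, f x = g x.
Proof.
move=> fc gc fg x; apply/eqP; rewrite -subr_eq0 -normr_eq0 eq_le normr_ge0 andbT.
apply/ler_addgt0Pr => e e0; rewrite add0r leNgt; apply/negP => efg.
have hc : `|f y - g y| @[y --> x] --> `|f x - g x|.
  have dc : {for x, continuous (f - g)} by apply: continuousB; [exact: fc|exact: gc].
  exact: (cvg_norm dc).
have /cvgr_gt/(_ e efg)[P Px PE] := hc.
(* A neighbourhood of a row vector contains a product of coordinate neighbourhoods [P 0 j]; a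
   rational is picked in each. *)
have /choice[q qP] : forall j, exists q : rat, P 0 j (ratr q).
  move=> j; have /nbhs_ballP[d /= d0 dP] := Px 0 j.
  have /rat_in_itvoo[q] : x 0 j < x 0 j + d by rewrite ltrDl.
  rewrite in_itv/= => /andP[xq qx]; exists q; apply: dP.
  by rewrite /ball/= ltr0_norm ?subr_lt0// opprB ltrBlDl.
have : e < `|f (map_mx ratr (\row_j q j)) - g (map_mx ratr (\row_j q j))|.
  by apply: PE => i j; rewrite !mxE (ord1 i).
by rewrite fg subrr normr0 ltNge ltW.
Qed.

(** On the moment curve [u = (1, t, t^2, ...)] the product with [w i] is the value at [t] of the
    polynomial with coefficients [w i], so any [t] outside finitely many roots will do. *)
Lemma generic_rat_vector (n : nat) (I : finType) (P : pred I)
    (w : I -> 'rV[rat]_n) : (forall i, P i -> w i != 0) ->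
  exists u : 'rV[rat]_n, forall i, P i -> (w i *m u^T) 0 0 != 0.
Proof.
move=> w0; pose p := \prod_(i | P i) rVpoly (w i).
have p0 : p != 0.
  apply/prodf_neq0 => i /w0; apply: contra => /eqP wi0.
  by rewrite -(rVpolyK (w i)) wi0 linear0.
have [t pt] : exists t : rat, ~~ root p t.
  (* These are [size p] distinct rationals, more than [p] has roots. *)
  pose rs : seq rat := [seq k%:R | k <- iota 0 (size p)].
  have /allPn[t _ pt] : ~~ all (root p) rs.
    apply/negP => prs; have := max_poly_roots p0 prs.
    rewrite size_map size_iota ltnn map_inj_uniq ?iota_uniq; first by move=> /(_ isT).
    by move=> a b /eqP; rewrite eqr_nat => /eqP.
  by exists t.
exists (\row_j t ^+ j) => i Pi; apply: contra pt => /eqP wit.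
rewrite /root horner_prod (bigD1 i)//= [X in X * _](_ : _ = 0) ?mul0r//.
rewrite -wit mxE (@horner_coef_wide _ n) ?size_poly//.
by apply: eq_bigr => j _; rewrite coef_rVpoly_ord !mxE.
Qed.

(** * Dot products and the adjoint of [T] *)

Lemma dotvE (R : realType) (n : nat) (u v : 'rV[R]_n) : dotv u v = (u *m v^T) 0 0.
Proof. by rewrite mxE; apply: eq_bigr => j _; rewrite mxE. Qed.

Lemma dotv_ratr (R : realType) (n : nat) (p q : 'rV[rat]_n) :
  dotv (map_mx ratr p) (map_mx ratr q) = ratr ((p *m q^T) 0 0) :> R.
Proof.
rewrite mxE rmorph_sum; apply: eq_bigr => j _.
by rewrite !mxE -rmorphM.
Qed.

(** The change of variables: substituting [y *m B] for the point, with [B] the adjoint of [T],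
    replaces each direction by its image under [T]. *)
Lemma dotv_adjoint (R : realType) (n : nat) (T : {linear 'rV[R]_n -> 'rV[R]_n})
    (u v : 'rV[R]_n) : dotv u (v *m (lin1_mx T)^T) = dotv (T u) v.
Proof. by rewrite !dotvE trmx_mul trmxK mulmxA mul_rV_lin1. Qed.

Lemma dotv_continuous (R : realType) (n : nat) (u : 'rV[R]_n) :
  continuous (dotv u).
Proof.
apply: continuous_big => [|j _ x]; first exact: add_continuous.
apply: (@continuousM R 'rV[R]_n (cst (u 0 j)) (fun v => v 0 j)).
  exact: cst_continuous.
exact: coord_continuous.
Qed.

Lemma mulmx_continuous (R : realType) (n : nat) (B : 'M[R]_n) :
  continuous (fun v : 'rV[R]_n => v *m B).
Proof.
under eq_fun do rewrite mulmx_sum_row.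
apply: continuous_big => [|j _ x]; first exact: add_continuous.
exact: cvgZr_tmp (@coord_continuous R 1 n 0 j x).
Qed.

(** * Reduction to a rational plane and conclusion *)

(** A single plane is enough: since [alpha i] is a nonzero rational, [phi i] records [f_ i] at every
    rational, hence at every [q i *m y^T] with [y] rational. *)
Lemma rational_ridge_sum (R : realType) (s n k : nat) (q : 'I_k -> 'rV[rat]_n)
    (B : 'M[R]_n) (f : 'rV[R]_n -> R) (f_ : 'I_k -> R -> R) :
  (forall i, q i != 0) ->
  (forall i j, i != j -> forall c : rat, q j != c *: q i) ->
  class_Cn s f ->
  (forall y : 'rV[rat]_n, f (map_mx ratr y *m B) =
     \sum_(i < k) f_ i (ratr ((q i *m y^T) 0 0))) ->
  exists2 g : 'I_k -> R -> R, forall i, class_C1 s (g i) &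
    forall y : 'rV[R]_n, f (y *m B) =
      \sum_(i < k) g i (dotv (map_mx ratr (q i)) y).
Proof.
move=> q0 qI fs fE.
have [u uP] := generic_rat_vector _ _ xpredT q (fun i _ => q0 i).
pose alpha i := (q i *m u^T) 0 0.
have alpha0 i : alpha i != 0 by exact: uP.
(* beta i = beta j iff v is orthogonal to alpha i *: q j - alpha j *: q i. *)
have w0 (p : 'I_k * 'I_k) : p.1 != p.2 ->
    alpha p.1 *: q p.2 - alpha p.2 *: q p.1 != 0.
  move=> /qI p12; rewrite subr_eq0; apply: contra (p12 (alpha p.2 / alpha p.1)).
  by move=> /eqP pE; rewrite mulrC -scalerA -pE scalerA mulVf// scale1r.
have [v vP] := generic_rat_vector _ _ (fun p => p.1 != p.2) _ w0.
pose beta i := (q i *m v^T) 0 0 / alpha i.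
have beta_inj : injective beta.
  move=> i j ij; apply/eqP; apply: contraT => /(vP (i, j))/=.
  rewrite mulmxBl -!scalemxAl !mxE => /negP[]; rewrite subr_eq0.
  have E l : (q l *m v^T) 0 0 = beta l * alpha l by rewrite /beta divfK.
  by move: (E i) (E j); rewrite !mxE => -> ->; rewrite ij; apply/eqP; ring.
pose F (p : R * R) := f (p.1 *: (map_mx ratr u *m B) + p.2 *: (map_mx ratr v *m B)).
have Fs : class_C1x R s F by exact: class_C1x_plane.
(* On the plane the i-th argument is [alpha i * (x + beta i * y)]; the factor [alpha i] is put into
   the function. *)
pose phi i (t : rat) := f_ i (ratr (alpha i * t)).
have FE (x y : rat) : F (ratr x, ratr y) =
    \sum_(i in [set: 'I_k]%SET) phi i (x + beta i * y).
  have -> : F (ratr x, ratr y) = f (map_mx ratr (x *: u + y *: v) *m B).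
    by rewrite /F/= map_mxD !map_mxZ mulmxDl -!scalemxAl.
  rewrite fE [RHS](eq_bigl xpredT) => [|i]; last by rewrite finset.in_setT.
  apply: eq_bigr => i _; rewrite /phi; congr (f_ i (ratr _)).
  rewrite linearD !linearZ mulmxDr -!scalemxAr mxE [X in X + _]mxE [X in _ + X]mxE.
  rewrite -/(alpha i) /beta; field; exact: alpha0.
have /choice[g gP] : forall i, exists g : R -> R, class_C1 s g /\
    forall t : rat, phi i t = g (ratr t).
  move=> i; have [//|g gs gE] := plane_ridge_summand
    _ _ _ _ [set: 'I_k]%SET phi F beta_inj Fs FE i.
  by exists g.
have gs i : class_C1 s (fun x => g i ((ratr (alpha i))^-1 * x)).
  have := class_C1_affine _ _ 1 0 (ratr (alpha i))^-1 _ (gP i).1.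
  by under eq_fun do rewrite mul1r addr0.
exists (fun i x => g i ((ratr (alpha i))^-1 * x)) => //.
(* Only now does the identity pass from rational to real [y]: both sides are continuous, whereas the
   [f_ i] need not be. *)
apply: continuous_eq_on_ratvec => [x||y].
- exact: (@continuous_comp 'rV[R]_n 'rV[R]_n R (fun y => y *m B) f x
    (mulmx_continuous R n B x) (class_Cn_continuous R n s f fs _)).
- apply: continuous_big => [|i _ x]; first exact: add_continuous.
  apply: (@continuous_comp _ _ _ (dotv (map_mx ratr (q i)))
    (fun x => g i ((ratr (alpha i))^-1 * x))).
    exact: dotv_continuous.
  exact: class_C1_continuous (gs i) _.
rewrite fE; apply: eq_bigr => i _; rewrite dotv_ratr -fmorphV -rmorphM.
by rewrite -(gP i).2 /phi mulVKf.
Qed.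

Theorem theorem2p8 (R : realType) (s n k : nat) (a : 'I_k -> 'rV[R]_n)
    (indep_a : forall i j : 'I_k, i != j -> free [:: a i; a j])
    (f : 'rV[R]_n -> R) (f_Cs : class_Cn s f)
    (f_sum : exists f_ : 'I_k -> R -> R,
       forall x : 'rV[R]_n, f x = \sum_(i < k) f_ i (dotv (a i) x))
    (rat_a : exists T : {linear 'rV[R]_n -> 'rV[R]_n},
       bijective T /\ forall i : 'I_k, ratvec (T (a i))) :
  exists g : 'I_k -> R -> R,
    (forall i : 'I_k, class_C1 s (g i)) /\
    (forall x : 'rV[R]_n, f x = \sum_(i < k) g i (dotv (a i) x)).
Proof.
have [f_ fE] := f_sum; have [T [Tbij /choice[q qE]]] := rat_a.
(* A zero direction cannot belong to an independent pair, so it can occur only when it is the sole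
   direction; then [f] is constant. *)
have [/existsP[i /eqP ai0]|] := boolP [exists i, a i == 0].
  have only j : j = i.
    apply/eqP; apply: contraT => /indep_a; rewrite ai0 free_cons seq1_free.
    by rewrite eqxx andbF.
  exists (fun i _ => f_ i 0); split=> [j|x]; first exact: class_C1_cst.
  rewrite fE; apply: eq_bigr => j _; rewrite (only j) ai0.
  by rewrite dotvE mul0mx mxE.
rewrite negb_exists => /forallP a0.
have Tinj := bij_inj Tbij.
pose B := (lin1_mx T)^T.
have q0 i : q i != 0.
  apply: contra (a0 i) => /eqP qi0; apply/eqP/Tinj.
  by rewrite qE qi0 map_mx0 linear0.
have qI i j : i != j -> forall c : rat, q j != c *: q i.
  rewrite eq_sym => /indep_a + c; rewrite free_cons span_seq1 => /andP[/negP aji _].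
  apply/eqP => qji; apply: aji; apply/vlineP; exists (ratr c).
  by apply: Tinj; rewrite linearZ !qE qji map_mxZ.
have [|g gs gE] := rational_ridge_sum R s n k q B f f_ q0 qI f_Cs.
  by move=> y; rewrite fE; apply: eq_bigr => i _; rewrite dotv_adjoint qE dotv_ratr.
exists g; split=> // x.
(* Injectivity of [T] makes [B] invertible, so every [x] has the form [y *m B]. *)
have Bu : B \in unitmx.
  rewrite unitmx_tr; have [T' TK T'K] := Tbij.
  rewrite -row_free_unit -kermx_eq0; apply/rowV0P => z /sub_kermxP.
  by rewrite mul_rV_lin1 => Tz; apply: Tinj; rewrite Tz linear0.
rewrite -(mulmxKV Bu x) gE; apply: eq_bigr => i _.
by rewrite dotv_adjoint qE.
Qed.
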